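(* For any polynomial $q\colon\mathbb C\to\mathbb C$ and any $\epsilon>0$, there is an $N\ge2$ such that for all integers $n\ge N$, \[K(f_n)\subset\mathbb D_{1+\epsilon},\] where $f_n(z)=z^n+q(z)$.
   Context: The filled Julia set $K(f)$ of $f\colon\mathbb C\to\mathbb C$ is the set of points of $\mathbb C$ whose orbit under iteration of $f$ is bounded. For $r>0$, $\mathbb D_r=\{z\in\mathbb C:|z|<r\}$. *)

(* Defs.v *)
From HB Require Import structures.
From mathcomp Require Import all_boot all_order all_algebra.
From mathcomp Require Import all_classical all_reals all_analysis.
From mathcomp Require Import complex.

Set Implicit Arguments.
Unset Strict Implicit.
Unset Printing Implicit Defensive.

Import Order.TTheory GRing.Theory Num.Theory.
Import numFieldNormedType.Exports.

Local Open Scope classical_set_scope.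
Local Open Scope ring_scope.
Local Open Scope complex_scope.

(* [R[i]^o] is [R[i]] as a normed module over itself, needed by [bounded_set]. *)
Definition filled_julia (R : realType) (f : R[i] -> R[i]) : set R[i] :=
  [set z | bounded_set (range (fun k : nat => iter k f z : R[i]^o))].

(* The norm of [R[i]] takes its values in [R[i]], hence the embedding of [r]. *)
Definition disk (R : realType) (r : R) : set R[i] :=
  [set z | `|z| < r%:C].

(* Main.v *)
Require Import Defs.
From mathcomp Require Import all_boot all_order all_algebra.
From mathcomp Require Import all_classical all_reals all_analysis.
From mathcomp Require Import complex.
Import Order.TTheory GRing.Theory Num.Theory.
Import numFieldNormedType.Exports.
Local Open Scope classical_set_scope.
Local Open Scope ring_scope.
Local Open Scope complex_scope.

(** Let [r = 1 + e], let [d] be the size of [q] and [C] the sum of the moduli of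
    its coefficients, so that [|q(z)| <= C |z|^d] as soon as [|z| >= 1].  If
    [n = m + d + 1] and [r^m >= C + r], then for [|z| >= r] we get
    [|z|^n >= (C + r) |z|^(d+1) >= C |z|^d + r |z|], hence [|f_n(z)| >= r |z|]:
    every orbit starting outside the disk of radius [r] grows geometrically. *)

Lemma norm_horner_le (K : numDomainType) (q : {poly K}) (x : K) :
  1 <= `|x| ->
  `|q.[x]| <= (\sum_(i < size q) `|q`_i|) * `|x| ^+ size q.
Proof.
move=> x1; rewrite horner_coef mulr_suml.
apply: le_trans (ler_norm_sum _ _ _) _; apply: ler_sum => i _.
by rewrite normrM normrX ler_wpM2l// ler_weXn2l// ltnW.
Qed.

Lemma norm_expn_horner_ge (K : numDomainType) (q : {poly K}) (r x : K) (m : nat) :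
  1 <= r -> \sum_(i < size q) `|q`_i| + r <= r ^+ m -> r <= `|x| ->
  r * `|x| <= `|x ^+ (m + (size q).+1) + q.[x]|.
Proof.
set C := \sum_(i < _) _ => r1 hm rx.
have x1 : 1 <= `|x| := le_trans r1 rx.
have r0 : 0 <= r := le_trans ler01 r1.
have C0 : 0 <= C by apply: sumr_ge0.
apply: le_trans (lerB_normD _ _).
rewrite lerBrDl; apply: (@le_trans _ _ ((C + r) * `|x| ^+ (size q).+1)); last first.
  rewrite normrX exprD ler_wpM2r ?exprn_ge0//.
  by apply: le_trans hm _; rewrite lerXn2r ?nnegrE.
rewrite mulrDl lerD//.
  apply: le_trans (norm_horner_le _ _ _ x1) _.
  by rewrite ler_wpM2l// ler_weXn2l.
by rewrite ler_wpM2l// -[leLHS]expr1 ler_weXn2l.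
Qed.

(** Each iterate gains a factor [r], and [r ^+ k.+1 >= r] keeps it in the region where [hf] applies
    again. *)
Lemma norm_iter_ge (K : numDomainType) (f : K -> K) (r x : K) :
  1 <= r -> (forall y, r <= `|y| -> r * `|y| <= `|f y|) -> r <= `|x| ->
  forall k, r ^+ k.+1 <= `|iter k f x|.
Proof.
move=> r1 hf rx; elim=> [|k IHk]; first by rewrite expr1.
have r0 : 0 <= r := le_trans ler01 r1.
rewrite exprS iterS; apply: le_trans (ler_wpM2l r0 IHk) (hf _ _).
by apply: le_trans IHk; rewrite -[leLHS]expr1 ler_weXn2l.
Qed.

Lemma bernoulli (K : numDomainType) (e : K) (n : nat) :
  0 <= e -> 1 + e *+ n <= (1 + e) ^+ n.
Proof.
move=> e0; elim: n => [|n IHn]; first by rewrite mulr0n addr0.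
have e1 : 0 <= 1 + e by rewrite addr_ge0.
rewrite exprS; apply: le_trans (ler_wpM2l e1 IHn).
by rewrite mulrDl mul1r mulrDr mulr1 mulrSr !addrA lerDl mulr_ge0// mulrn_wge0.
Qed.

Lemma expr_unbounded (K : archiRealFieldType) (e x : K) :
  0 < e -> exists n : nat, x < (1 + e) ^+ n.
Proof.
move=> e0; have xe : 0 <= `|x| / e by rewrite divr_ge0// ltW.
(* By Bernoulli, any [n] above [|x| / e] suffices. *)
exists (Num.Def.archi_bound (`|x| / e)).
apply: lt_le_trans (bernoulli _ _ _ (ltW e0)).
rewrite ltr_pwDl// -mulr_natr mulrC.
by apply: le_trans (ler_norm _) _; rewrite -ler_pdivrMr// ltW// archi_boundP.
Qed.

(** The order of [R[i]] is partial; a real [x] comes from [R], where the Archimedean argument is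
    available. *)
Lemma complex_expr_unbounded (R : realType) (e : R) (x : R[i]) :
  0 < e -> x \is Num.real -> exists n : nat, x < (1 + e)%:C ^+ n.
Proof.
move=> e0 /complex_realP[a ->].
have [n an] := expr_unbounded _ _ a e0.
by exists n; rewrite -rmorphXn ltcR.
Qed.

Theorem lemma1p2 (R : realType) (q : {poly R[i]}) (e : R) (he : 0 < e) :
  exists N : nat, (2 <= N)%N /\
    forall n : nat, (N <= n)%N ->
      filled_julia (fun z : R[i] => z ^+ n + q.[z]) `<=` disk (1 + e).
Proof.
set r := (1 + e)%:C.
have r1 : 1 <= r by rewrite -[1]/(1%:C) lecR lerDl ltW.
have r0 : 0 <= r := le_trans ler01 r1.
have C0 : 0 <= \sum_(i < size q) `|q`_i| by apply: sumr_ge0.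
have [m hm] := complex_expr_unbounded _ _ _ he (ger0_real (addr_ge0 C0 r0)).
(* The [.+2] only serves to make [2 <= N] immediate. *)
exists (m + (size q).+1).+2; split=> // n hn z.
rewrite /filled_julia /disk /= => hb.
(* Negating [<] is legitimate here because both sides are nonnegative, hence real and comparable. *)
rewrite real_ltNge ?ger0_real//; apply/negP => rz.
have [M M0 hM] := ex_strict_bound_gt0 hb.
have [k hk] := complex_expr_unbounded _ _ _ he (gtr0_real M0).
have hf (y : R[i]) : r <= `|y| -> r * `|y| <= `|y ^+ n + q.[y]|.
  have hn' : ((size q).+1 <= n)%N.
    by apply: leq_trans hn; rewrite -addn2 -addnA addnC -addnA leq_addr.
  (* The role of [m] is played by [n - (size q).+1], which is at least [m]. *)
  rewrite -(subnK hn'); apply: norm_expn_horner_ge => //.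
  apply: le_trans (ltW hm) _; rewrite ler_weXn2l// leq_subRL// addnC.
  exact: ltnW (ltnW hn).
(* The [k]-th iterate would have modulus below [M < r ^+ k], yet at least [r ^+ k.+1]. *)
have := hM (iter k (fun z : R[i] => z ^+ n + q.[z]) z) (ex_intro2 _ _ k I erefl).
move=> /= /lt_trans/(_ hk); rewrite real_ltNge ?ger0_real ?exprn_ge0// => /negP; apply.
apply: le_trans (norm_iter_ge _ _ _ _ r1 hf rz k).
by rewrite ler_weXn2l.
Qed.
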